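(* Let $n\ge 2$ and $d$ be integers with $0\le d\le (\sqrt{8n-15}-1)/4$. If $G$ is an $n$-vertex graph with minimum degree $\delta(G)\ge \frac{n+d}{2}-1$, then $G$ is $d$-rigid.
   Context: Graphs are finite and simple; $\delta(G)$ denotes the minimum degree of $G$. A $d$-dimensional framework is a pair $(G,\mathbf{p})$ with $G=(V,E)$ a graph and $\mathbf{p}:V\to\mathbb{R}^d$. It is rigid if every continuous motion of the vertices starting from $\mathbf{p}$ that preserves the distances between all pairs of adjacent vertices is trivial (arises from translations and rotations of the whole framework). $\mathbf{p}$ is generic if its $d|V|$ coordinates are algebraically independent over $\mathbb{Q}$. $G$ is $d$-rigid if $(G,\mathbf{p})$ is rigid for a generic $\mathbf{p}$ (this does not depend on the generic $\mathbf{p}$). It is assumed that $|V|\ge d+1$ when discussing $d$-rigidity. Equivalently (Asimow–Roth), $G$ is $d$-rigid if, for a generic $\mathbf{p}$, the rigidity matrix $\mathsf{R}(G,\mathbf{p})$ has rank $d|V|-\binom{d+1}{2}$ (the maximum possible), where $\mathsf{R}(G,\mathbf{p})$ has rows indexed by $E$, columns indexed by $V\times[d]$, and the entry in row $e$ and column $(u,i)$ is $\mathbf{p}(u)_i-\mathbf{p}(v)_i$ if $e=\{u,v\}$ for some $v\in V$, and $0$ if $u\notin e$. *)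

(* Defs.v *)
From mathcomp Require Import all_boot all_order all_algebra.
From mathcomp Require Import all_classical all_reals all_analysis.
(* The notations of mpoly clash with those of mathcomp-analysis, and its
   symmetric shadows the one on relations. *)
From mathcomp Require Import (canonicals,coercions) mpoly.

Set Implicit Arguments.
Unset Strict Implicit.
Unset Printing Implicit Defensive.

Import Order.TTheory GRing.Theory Num.Theory.
Import numFieldNormedType.Exports.

Local Open Scope classical_set_scope.
Local Open Scope ring_scope.

Record sgraph (V : finType) := SGraph {
  adj :> rel V;
  adj_sym : symmetric adj;
  adj_irr : irreflexive adj }.

Definition degree (V : finType) (G : sgraph V) (v : V) : nat :=
  #|[pred u | G v u]|.

(* The default value #|V| exceeds every degree, so this is the true minimum
   whenever V is nonempty. *)
Definition min_degree (V : finType) (G : sgraph V) : nat :=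
  \big[minn/#|V|]_(v : V) degree G v.

Section Frameworks.
Variables (R : realType) (V : finType) (d : nat).

(* The library norm `|x| on row vectors is the sup norm, hence the explicit
   Euclidean formula. *)
Definition eucl_dist (x y : 'rV[R]_d) : R :=
  Num.sqrt (\sum_(i < d) (x 0 i - y 0 i) ^+ 2).

Definition placement := V -> 'rV[R]_d.

(* Time runs over [0, 1]; values of gamma outside [0, 1] are irrelevant. *)
Definition motion (G : sgraph V) (p : placement) (gamma : R -> placement) :=
  [/\ forall v, {within `[0, 1], continuous (fun t => gamma t v)},
      forall v, gamma 0 v = p v &
      forall (t : R) u v, t \in `[0, 1] -> G u v ->
        eucl_dist (gamma t u) (gamma t v) = eucl_dist (p u) (p v)].

Definition rotation (A : 'M[R]_d) := A *m A^T = 1%:M /\ \det A = 1.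

Definition trivial_motion (p : placement) (gamma : R -> placement) :=
  exists (A : R -> 'M[R]_d) (b : R -> 'rV[R]_d),
    [/\ {within `[0, 1], continuous A} /\ {within `[0, 1], continuous b},
        A 0 = 1%:M /\ b 0 = 0,
        forall t : R, t \in `[0, 1] -> rotation (A t) &
        forall (t : R) v, t \in `[0, 1] -> gamma t v = p v *m A t + b t].

Definition rigid (G : sgraph V) (p : placement) :=
  forall gamma, motion G p gamma -> trivial_motion p gamma.

(* Algebraic independence over the rationals of the d|V| coordinates of p,
   which are numbered through the enumeration of V * 'I_d. *)
Definition generic (p : placement) :=
  forall P : mpoly.mpoly #|{: V * 'I_d}| rat,
    mpoly.mmap (ratr : rat -> R)
      (fun k => p (enum_val k).1 0 (enum_val k).2) P = 0 -> P = 0.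

End Frameworks.

(* Rigidity at one generic placement is equivalent to rigidity at all of them,
   and generic placements exist since R is uncountable. *)
Definition d_rigid (R : realType) (V : finType) (d : nat) (G : sgraph V) :=
  forall p : placement R V d, generic p -> rigid G p.

(* Main.v *)
(* Write R_p(G) for the rigidity matrix at the generic placement p and call x, y
   linked when the row of xy lies in the row space of R_p(G). If some pair is
   not linked, then no vertex has a clique of linked vertices as its linked
   neighbourhood: two unlinked vertices have at least d common neighbours, and
   a clique on d vertices joined to both x and y links x and y.
   Expose the vertices of the linked graph in random order (Villanyi). A new
   vertex with j earlier neighbours raises the rank by at least min(d, j), and
   by d + 1 if j > d and two earlier neighbours are unlinked. Averaging gives
   rank R_p(G) >= dn - d(d+1)/2, the rank of the complete graph, so all pairs
   are linked after all.
   If p and q have equal edge lengths then q - p is an infinitesimal motion of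
   (p + q) / 2; for q near p this framework is infinitesimally rigid, hence all
   distances agree. By connectedness of [0, 1] a motion preserves all distances
   for all times, so it consists of isometries. *)

From HB Require Import structures.
Require Import Defs.
From mathcomp Require Import all_boot all_order all_algebra.
From mathcomp Require Import all_classical all_reals all_analysis.
From mathcomp Require Import (canonicals,coercions) mpoly.
From mathcomp Require Import zify ring lra.

Set Implicit Arguments.
Unset Strict Implicit.
Unset Printing Implicit Defensive.

Import Order.TTheory GRing.Theory Num.Theory.
Import numFieldNormedType.Exports.

Local Open Scope ring_scope.

(** * Rigidity matrices and generic rank *)

Lemma sum_delta (S : nzRingType) (I : finType) (g : I -> S) i :
  \sum_j (j == i)%:R * g j = g i.
Proof.
rewrite (bigD1 i) //= eqxx mul1r big1 ?addr0 // => j /negPf ->.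
by rewrite mul0r.
Qed.

Lemma mxrank_mxsub (F : fieldType) m n m' n' (f : 'I_m' -> 'I_m)
    (g : 'I_n' -> 'I_n) (A : 'M[F]_(m, n)) :
  (\rank (mxsub f g A) <= \rank A)%N.
Proof.
rewrite -[A]mulmx1 mxsub_mul rowsubE mulmx1.
exact: leq_trans (mxrankM_maxl _ _) (mxrankM_maxr _ _).
Qed.

Lemma rank_minor_le (F : fieldType) m n r (A : 'M[F]_(m, n))
    (f : 'I_r -> 'I_m) (g : 'I_r -> 'I_n) :
  \det (mxsub f g A) != 0 -> (r <= \rank A)%N.
Proof.
rewrite -unitfE -unitmxE => /mxrank_unit <-; exact: mxrank_mxsub.
Qed.

Lemma rank_minor_ex (F : fieldType) m n (A : 'M[F]_(m, n)) :
  exists (f : 'I_(\rank A) -> 'I_m) (g : 'I_(\rank A) -> 'I_n),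
    \det (mxsub f g A) != 0.
Proof.
pose B := rowsub (maxrankfun A) A.
have full : row_full B^T by rewrite /row_full mxrank_tr; exact: maxrowsub_free.
exists (maxrankfun A), (fullrankfun full).
have -> : mxsub (maxrankfun A) (fullrankfun full) A
          = (rowsub (fullrankfun full) B^T)^T by apply/matrixP=> i j; rewrite !mxE.
by rewrite det_tr -unitfE -unitmxE fullrowsub_unit.
Qed.

(** The evaluation map of [generic]: genericity of [q] says that this ring morphism has trivial
    kernel. *)
Definition polyeval (R : realType) (V : finType) (d : nat)
    (q : placement R V d) :=
  mpoly.mmap (ratr : rat -> R)
    (fun k : 'I_#|{: V * 'I_d}| => q (enum_val k).1 0 (enum_val k).2).

HB.instance Definition _ R V d (q : placement R V d) :=
  GRing.RMorphism.copy (polyeval q) (mpoly.mmap _ _).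

(** A minor that is nonzero at [q] comes from a nonzero polynomial, which cannot vanish at the
    generic [p]. *)
Lemma generic_rank (R : realType) (V : finType) (d : nat)
    (p q : placement R V d) m n
    (M : 'M[mpoly.mpoly #|{: V * 'I_d}| rat]_(m, n)) :
  generic p ->
  (\rank (map_mx (polyeval q) M) <= \rank (map_mx (polyeval p) M))%N.
Proof.
move=> gp; have [f [g nz]] := rank_minor_ex (map_mx (polyeval q) M).
apply: (@rank_minor_le _ _ _ _ _ f g); move: nz.
rewrite -!map_mxsub !det_map_mx; apply: contra_neq => /gp ->.
exact: rmorph0.
Qed.

Section RigidityMatrix.
Variables (S : comNzRingType) (V : finType) (d : nat).
Implicit Types (e : rel V) (q : V -> 'rV[S]_d).

(** Available for every pair, so that non-edges can be tested against a row space, and over any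
    commutative ring, so that indeterminates can serve as coordinates. *)
Definition edge_row q (x y : V) : 'rV[S]_#|{: V * 'I_d}| :=
  \row_l ((((enum_val l).1 == x)%:R - ((enum_val l).1 == y)%:R) *
          (q x 0 (enum_val l).2 - q y 0 (enum_val l).2)).

(** Non-edges give zero rows and, for symmetric [e], each edge occurs twice; neither affects the
    rank. *)
Definition rigidity_matrix e q : 'M[S]_(#|{: V * V}|, #|{: V * 'I_d}|) :=
  \matrix_k (if e (enum_val k).1 (enum_val k).2
             then edge_row q (enum_val k).1 (enum_val k).2 else 0).

Definition vertex_proj (u : V) : 'M[S]_(#|{: V * 'I_d}|, d) :=
  \matrix_(l, i) (enum_val l == (u, i))%:R.

Lemma mul_vertex_proj m u (A : 'M[S]_(m, _)) i j :
  (A *m vertex_proj u) i j = A i (enum_rank (u, j)).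
Proof.
rewrite mxE (bigD1 (enum_rank (u, j))) //= mxE enum_rankK eqxx mulr1.
rewrite big1 ?addr0 // => k; rewrite -(inj_eq enum_val_inj) enum_rankK mxE.
by move=> /negPf ->; rewrite mulr0.
Qed.

Lemma edge_rowC q x y : edge_row q x y = edge_row q y x.
Proof. by apply/rowP=> l; rewrite !mxE; ring. Qed.

Lemma edge_row_diag q x : edge_row q x x = 0.
Proof. by apply/rowP=> l; rewrite !mxE subrr mul0r. Qed.

Lemma edge_row_proj q x y u :
  edge_row q x y *m vertex_proj u = ((u == x)%:R - (u == y)%:R) *: (q x - q y).
Proof. by apply/rowP=> i; rewrite mul_vertex_proj !mxE enum_rankK. Qed.

End RigidityMatrix.

Section RowSpace.
Variables (F : fieldType) (V : finType) (d : nat).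
Implicit Types (e : rel V) (q : V -> 'rV[F]_d).

Lemma rigidity_matrix_subP e q m (B : 'M[F]_(m, _)) :
  reflect (forall x y, e x y -> (edge_row q x y <= B)%MS)
          (rigidity_matrix e q <= B)%MS.
Proof.
apply: (iffP row_subP) => [sub x y exy|sub k].
  by have := sub (enum_rank (x, y)); rewrite rowK enum_rankK /= exy.
by rewrite rowK; case: ifP => [/sub //|_]; exact: sub0mx.
Qed.

Lemma edge_row_sub e q x y :
  e x y -> (edge_row q x y <= rigidity_matrix e q)%MS.
Proof. by apply/rigidity_matrix_subP. Qed.

End RowSpace.

(** Rank-nullity for [P] on the row space of [A]: the kernel contains [B], the image has rank at
    least [j]. *)
Lemma mxrank_add_ker (F : fieldType) m1 m2 n k j (A : 'M[F]_(m1, n))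
    (B : 'M[F]_(m2, n)) (P : 'M[F]_(n, k)) :
  (B <= A)%MS -> B *m P = 0 -> (j <= \rank (A *m P))%N ->
  (\rank B + j <= \rank A)%N.
Proof.
move=> BA BP jA; rewrite -(mxrank_mul_ker A P) addnC leq_add //.
by apply: mxrankS; rewrite sub_capmx BA; apply/sub_kermxP.
Qed.

(** Deleted vertices keep their columns, so all row spaces lie in one ambient space. *)
Definition induced (V : finType) (e : rel V) (W : {set V}) : rel V :=
  [rel x y | [&& e x y, x \in W & y \in W]].

Notation neighbours e W u := [set w in W | e u w]%SET.

(** * Generic placements maximize ranks *)

Section Generic.
Variables (R : realType) (V : finType) (d : nat) (p : placement R V d).
Hypothesis p_gen : generic p.

Local Notation poly := (mpoly.mpoly #|{: V * 'I_d}| rat).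

Definition varX (x : V) : 'rV[poly]_d :=
  \row_i mpoly.mpolyX rat (mpoly.mnm1 (enum_rank (x, i))).

Lemma polyeval_varX (q : placement R V d) x i : polyeval q (varX x 0 i) = q x 0 i.
Proof.
by rewrite mxE /polyeval mpoly.mmapX mpoly.mmap1U enum_rankK.
Qed.

Lemma rigidity_rank_max (e : rel V) (q : placement R V d) :
  (\rank (rigidity_matrix e q) <= \rank (rigidity_matrix e p))%N.
Proof.
have ev_mx (r : placement R V d) :
    map_mx (polyeval r) (rigidity_matrix e varX) = rigidity_matrix e r.
  apply/matrixP=> k l; rewrite !mxE.
  case: ifP => _; rewrite ?mxE ?rmorph0 // rmorphM !rmorphB !rmorph_nat.
  by rewrite -!(polyeval_varX r) !mxE.
by rewrite -!ev_mx; exact: generic_rank.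
Qed.

(** Since generic rank is maximal, one placement with independent differences suffices. *)
Lemma generic_diff_free k (f : 'I_k -> V) x :
  injective f -> (forall i, f i != x) -> (k <= d)%N ->
  row_free (\matrix_i (p (f i) - p x)).
Proof.
move=> f_inj f_x kd.
pose M : 'M[poly]_(k, d) := \matrix_i (varX (f i) - varX x).
have ev_mx (r : placement R V d) : map_mx (polyeval r) M = \matrix_i (r (f i) - r x).
  by apply/matrixP=> i j; rewrite !mxE rmorphB -!(polyeval_varX r) !mxE.
(* Sends [f i] to the [i]-th basis vector and all other vertices, [x] among them, to the origin. *)
pose q : placement R V d :=
  fun y => \row_j ([exists i : 'I_k, (f i == y) && (i == j :> nat)])%:R.
rewrite /row_free eqn_leq rank_leq_row -ev_mx.
apply: leq_trans (generic_rank q _ p_gen); rewrite ev_mx.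
suff -> : \matrix_i (q (f i) - q x) = pid_mx k by rewrite rank_pid_mx.
apply/matrixP=> i j; rewrite !mxE.
have -> : [exists i0, (f i0 == x) && (i0 == j :> nat)] = false.
  by apply/existsP=> -[i0]; rewrite (negPf (f_x _)).
rewrite subr0 ltn_ord andbT; congr (nat_of_bool _)%:R.
apply/existsP/eqP => [[i0 /andP[/eqP/f_inj -> /eqP]] //|ij].
by exists i; rewrite eqxx ij eqxx.
Qed.


End Generic.

Lemma ord_inj_in (V : finType) (K : {set V}) k :
  (k <= #|K|)%N -> exists2 f : 'I_k -> V, injective f & forall i, f i \in K.
Proof.
move=> kK; exists (fun i => enum_val (widen_ord kK i)) => [i j|i].
  by move=> /enum_val_inj/(congr1 val) /= /val_inj.
exact: enum_valP.
Qed.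

(** * Rank gained by one vertex; stresses and cliques *)

Section RankIncrement.
Variables (R : realType) (V : finType) (d : nat) (p : placement R V d).
Hypothesis p_gen : generic p.

Lemma generic_span_diff m (B : 'M[R]_(m, d)) (T : {set V}) x :
  x \notin T -> (forall w, w \in T -> (p w - p x <= B)%MS) ->
  (minn d #|T| <= \rank B)%N.
Proof.
move=> xT sub.
have [f f_inj fT] := ord_inj_in (geq_minr d #|T|).
have fx i : f i != x by apply: contraNneq xT => <-.
have /eqP <- := generic_diff_free p_gen f_inj fx (geq_minl _ _).
by apply/mxrankS/row_subP => i; rewrite rowK sub.
Qed.

Section Increment.
Variables (e : rel V) (W : {set V}) (u : V).
Implicit Types q : placement R V d.
Hypotheses (e_irr : irreflexive e) (uW : u \in W).
Local Notation N := (neighbours e W u).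

Let uN : u \notin N. Proof. by rewrite inE e_irr andbF. Qed.

Let edge_sub q w : w \in N ->
  (q u - q w <= rigidity_matrix (induced e W) q *m vertex_proj R d u)%MS.
Proof.
rewrite inE => /andP[wW euw].
have uw : (u == w) = false by apply: contraTF euw => /eqP <-; rewrite e_irr.
have -> : q u - q w = edge_row q u w *m vertex_proj R d u.
  by rewrite edge_row_proj eqxx uw subr0 scale1r.
by apply: submxMr; apply: edge_row_sub; rewrite /induced /= euw uW wW.
Qed.

Let induced_sub q :
  (rigidity_matrix (induced e (W :\ u)) q <= rigidity_matrix (induced e W) q)%MS.
Proof.
apply/rigidity_matrix_subP => x y /and3P[exy /setD1P[_ xW] /setD1P[_ yW]].
by apply: edge_row_sub; rewrite /induced /= exy xW yW.
Qed.

Let induced_proj q :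
  rigidity_matrix (induced e (W :\ u)) q *m vertex_proj R d u = 0.
Proof.
apply/row_matrixP => k; rewrite row_mul row0 rowK.
case: ifP => [/and3P[_ /setD1P[xu _] /setD1P[yu _]]|]; last by rewrite mul0mx.
by rewrite edge_row_proj ![u == _]eq_sym (negPf xu) (negPf yu) subrr scale0r.
Qed.

(** Rows avoiding [u] vanish on the columns of [u], whereas the rows at [u] restrict there to
    differences [p u - p w], of which genericity makes enough independent. *)
Lemma rank_increment :
  (\rank (rigidity_matrix (induced e (W :\ u)) p) + minn d #|N|
   <= \rank (rigidity_matrix (induced e W) p))%N.
Proof.
apply: (mxrank_add_ker (induced_sub p) (induced_proj p)).
apply: generic_span_diff uN _ => w /edge_sub sub.
by rewrite -opprB eqmx_opp.
Qed.

(* Placing u at the midpoint of x and y puts the row of xy in the span of the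
   rows of ux and uy; by genericity the rank at p is at least as large. *)
Lemma rank_increment_nonadjacent x y :
  (d < #|N|)%N -> x \in N -> y \in N ->
  ~~ (edge_row p x y <= rigidity_matrix e p)%MS ->
  (\rank (rigidity_matrix (induced e (W :\ u)) p) + d.+1
   <= \rank (rigidity_matrix (induced e W) p))%N.
Proof.
move=> dN xN yN nxy.
pose q : placement R V d := fun w => if w == u then 2^-1 *: (p x + p y) else p w.
have qE w : w != u -> q w = p w by rewrite /q => /negPf ->.
have neq w : w \in N -> w != u by apply: contraTneq => ->.
have qu : q u = 2^-1 *: (p x + p y) by rewrite /q eqxx.
set A := rigidity_matrix (induced e W) q.
set B := rigidity_matrix (induced e (W :\ u)) p.
have qB : rigidity_matrix (induced e (W :\ u)) q = B.
  apply/row_matrixP => k; rewrite !rowK; case: ifP => //.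
  move=> /and3P[_ /setD1P[/qE + _] /setD1P[/qE + _]].
  by rewrite /edge_row => -> ->.
have Be : (B <= rigidity_matrix e p)%MS.
  by apply/rigidity_matrix_subP => v w /and3P[evw _ _]; exact: edge_row_sub.
have rkB : (\rank B < \rank (B + edge_row p x y)%MS)%N.
  apply: rank_ltmx; rewrite ltmxE addsmxSl addsmx_sub negb_and orbC.
  by apply/orP; left; apply: contra nxy => /submx_trans; apply.
apply: leq_trans (rigidity_rank_max p_gen _ q); rewrite -/A.
rewrite addnS -addSn.
apply: leq_trans (leq_add rkB (leqnn d)) _.
apply: (@mxrank_add_ker _ _ _ _ _ _ _ _ (vertex_proj R d u)).
- rewrite addsmx_sub -qB induced_sub /=.
  (* In the sum of the two rows the entries at the midpoint [u] cancel. *)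
  have -> : edge_row p x y = 2 *: (edge_row q u x + edge_row q u y).
    apply/rowP => l; rewrite !mxE qu !(qE x, qE y) ?neq // !mxE.
    by field.
  apply/scalemx_sub/addmx_sub; apply: edge_row_sub.
    by move: xN; rewrite inE /induced /= uW => /andP[-> ->].
  by move: yN; rewrite inE /induced /= uW => /andP[-> ->].
- apply/eqP; rewrite -sub_kermx addsmx_sub !sub_kermx -{1}qB induced_proj eqxx /=.
  by rewrite edge_row_proj ![u == _]eq_sym !(negPf (neq _ _)) // subrr scale0r.
(* Differences are taken from [x] because these involve only the generic [p]; this uses up one
   neighbour, hence the strict bound on [d]. *)
- have dN1 : (d <= #|N :\ x|)%N by move: dN; rewrite (cardsD1 x) xN /=; lia.
  apply: leq_trans (_ : (d <= minn d #|N :\ x|)%N) _.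
    by rewrite leq_min leqnn.
  apply: (@generic_span_diff _ _ _ x); first by rewrite !inE eqxx.
  move=> w /setD1P[_ wN].
  have -> : p w - p x = (q u - q x) - (q u - q w).
    by rewrite (qE x (neq x xN)) (qE w (neq w wN)) opprB [RHS]addrC addrA subrK.
  by apply: addmx_sub; rewrite ?eqmx_opp edge_sub.
Qed.

End Increment.

(* The numbers a x * a y form an equilibrium stress of the complete graph. *)
Lemma edge_row_stress m (B : 'M[R]_(m, #|{: V * 'I_d}|)) (a : V -> R) (u v : V) :
  \sum_w a w = 0 -> \sum_w a w *: p w = 0 ->
  u != v -> a u != 0 -> a v != 0 ->
  (forall x y, a x != 0 -> a y != 0 -> y != u -> y != v ->
     (edge_row p x y <= B)%MS) ->
  (edge_row p u v <= B)%MS.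
Proof.
move=> a0 ap0 uv au av sub.
have stress : \sum_x \sum_y (a x * a y) *: edge_row p x y = 0.
  apply/rowP => l; rewrite !mxE summxE.
  set w := (enum_val l).1; set i := (enum_val l).2.
  have apl : \sum_x a x * p x 0 i = 0.
    move/rowP/(_ i): ap0; rewrite summxE [RHS]mxE; apply: etrans.
    by apply: eq_bigr => x _; rewrite mxE.
  (* Each edge row splits into its parts at [x] and at [y]. Both parts have the same total, which
     vanishes by the two conditions on [a]. *)
  pose s x y := a x * a y * ((w == x)%:R * (p x 0 i - p y 0 i)).
  have half : \sum_x \sum_y s x y = 0.
    rewrite (bigD1 w) //= [X in _ + X]big1 ?addr0 => [|x xw]; last first.
      by rewrite big1 // => y _; rewrite /s eq_sym (negPf xw) mul0r mulr0.
    transitivity (a w * (p w 0 i * (\sum_y a y) - \sum_y a y * p y 0 i)).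
      rewrite !mulr_sumr -sumrB mulr_sumr; apply: eq_bigr => y _.
      by rewrite /s eqxx mul1r; ring.
    by rewrite a0 apl; ring.
  transitivity (\sum_x \sum_y s x y + \sum_y \sum_x s x y).
    rewrite -big_split /=.
    apply: eq_bigr => x _; rewrite summxE -big_split /=.
    by apply: eq_bigr => y _; rewrite !mxE /s; ring.
  by rewrite [X in _ + X]exchange_big /= half addr0.
(* Modulo the row space of [B] only the terms of [uv] and [vu] survive, and these are equal. *)
rewrite submxE; set C := cokermx B.
pose h x y := (a x * a y) *: (edge_row p x y *m C).
have h0 x y : y != u -> y != v -> h x y = 0.
  move=> yu yv; rewrite /h; have [->|ax] := eqVneq (a x) 0.
    by rewrite mul0r scale0r.
  have [->|ay] := eqVneq (a y) 0; first by rewrite mulr0 scale0r.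
  by have := sub x y ax ay yu yv; rewrite submxE => /eqP ->; rewrite scaler0.
have hC x y : h x y = h y x by rewrite /h mulrC edge_rowC.
have hxx x : h x x = 0 by rewrite /h edge_row_diag mul0mx scaler0.
have : \sum_x \sum_y h x y = 0.
  transitivity ((\sum_x \sum_y (a x * a y) *: edge_row p x y) *m C).
    rewrite mulmx_suml; apply: eq_bigr => x _.
    by rewrite mulmx_suml; apply: eq_bigr => y _; rewrite /h scalemxAl.
  by rewrite stress mul0mx.
rewrite (bigD1 u) //= [X in _ + X](bigD1 v) 1?eq_sym //=.
rewrite [X in _ + (_ + X)]big1 ?addr0 => [|x /andP[xu xv]]; last first.
  by rewrite big1 // => y _; rewrite hC h0.
rewrite (bigD1 v) 1?eq_sym //= big1 ?addr0 => [|y yv]; last first.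
  by have [->|yu] := eqVneq y u; [exact: hxx | exact: h0].
rewrite (bigD1 u) //= big1 ?addr0 => [|y yu]; last first.
  by have [->|yv] := eqVneq y v; [exact: hxx | exact: h0].
rewrite [h v u]hC -mulr2n -scaler_nat /h => /eqP.
by rewrite !scaler_eq0 pnatr_eq0 (negPf au) (negPf av).
Qed.

(** The [d + 2] points at [u], [v] and [d] vertices of [K] are affinely dependent in dimension [d].
    By genericity the coefficients at [u] and [v] are nonzero, so the resulting stress expresses the
    row of [uv] through the others. *)
Lemma edge_row_clique m (B : 'M[R]_(m, #|{: V * 'I_d}|)) (K : {set V}) (u v : V) :
  (d <= #|K|)%N -> u != v -> u \notin K -> v \notin K ->
  (forall x y, x \in u |: (v |: K) -> y \in K -> (edge_row p x y <= B)%MS) ->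
  (edge_row p u v <= B)%MS.
Proof.
move=> dK uv uK vK sub; have [f f_inj fK] := ord_inj_in dK.
have fu i : f i != u by apply: contraNneq uK => <-.
have fv i : f i != v by apply: contraNneq vK => <-.
pose M w := \matrix_i (p (f i) - p w).
have cM w (c : 'rV[R]_d) : c *m M w = \sum_i c 0 i *: p (f i) - (\sum_i c 0 i) *: p w.
  rewrite scaler_suml -sumrB; apply/rowP => j; rewrite !mxE summxE.
  by apply: eq_bigr => i _; rewrite !mxE; ring.
have Mu : row_free (M u) by apply: generic_diff_free.
have Mv : row_full (M v) by rewrite /row_full -[X in _ == X]/d; apply: generic_diff_free.
have /submxP[c] := submx_full (p u - p v) Mv.
rewrite cM; set s := \sum_i c 0 i => pc.
(* Otherwise [p u] is an affine combination of the [p (f i)], against the independence of their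
   differences from [p u]. *)
have s1 : s != 1.
  apply/eqP => s1; have : c *m M u = 0 *m M u.
    rewrite mul0mx cM -/s s1 scale1r; move: pc.
    by rewrite s1 scale1r => /addIr ->; rewrite subrr.
  move/(row_free_inj Mu) => c0; have /eqP := oner_neq0 R; apply.
  by rewrite -s1 /s big1 // => i _; rewrite c0 mxE.
(* The affine dependence read off from [pc]; its coefficients sum to [1 + (s - 1) - s = 0]. *)
pose a w : R := (w == u)%:R + (s - 1) * (w == v)%:R - \sum_i c 0 i * (w == f i)%:R.
have aE (g : V -> R) :
    \sum_w a w * g w = g u + (s - 1) * g v - \sum_i c 0 i * g (f i).
  transitivity (\sum_w ((w == u)%:R * g w + (s - 1) * ((w == v)%:R * g w)
                        - \sum_i c 0 i * ((w == f i)%:R * g w))).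
    apply: eq_bigr => w _; rewrite /a mulrBl mulrDl mulr_suml -mulrA.
    by congr (_ - _); apply: eq_bigr => i _; rewrite mulrA.
  rewrite sumrB big_split /= -mulr_sumr !sum_delta exchange_big /=.
  by congr (_ - _); apply: eq_bigr => i _; rewrite -mulr_sumr sum_delta.
have au : a u = 1.
  rewrite /a eqxx (negPf uv) mulr0 addr0 big1 ?subr0 // => i _.
  by rewrite eq_sym (negPf (fu i)) mulr0.
have av : a v = s - 1.
  rewrite /a eqxx eq_sym (negPf uv) add0r mulr1 big1 ?subr0 // => i _.
  by rewrite eq_sym (negPf (fv i)) mulr0.
have aK w : a w != 0 -> w \in u |: (v |: K).
  apply: contraNT; rewrite !inE !negb_or => /and3P[/negPf wu /negPf wv wK].
  rewrite /a wu wv mulr0 addr0 big1 ?subr0 // => i _.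
  by rewrite (negPf (_ : w != f i)) ?mulr0 //; apply: contraNneq wK => ->.
apply: (edge_row_stress (a := a)) uv _ _ _.
- under eq_bigr do rewrite -[a _]mulr1.
  rewrite (aE (fun=> 1)); under eq_bigr do rewrite mulr1.
  by rewrite -/s mulr1; ring.
- apply/rowP => i; rewrite summxE mxE.
  under eq_bigr do rewrite mxE.
  rewrite (aE (fun w => p w 0 i)); move/rowP/(_ i): pc.
  rewrite !mxE summxE; under eq_bigr do rewrite mxE.
  by move=> pci; rewrite mulrBl mul1r; lra.
- by rewrite au oner_eq0.
- by rewrite av subr_eq0.
- move=> x y /aK xK /aK; rewrite !inE => + yu yv.
  by rewrite (negPf yu) (negPf yv); exact: sub.
Qed.

End RankIncrement.

Lemma rank_le_card (F : fieldType) (V : finType) d (e : rel V)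
    (q : V -> 'rV[F]_d) :
  (\rank (rigidity_matrix e q) <= #|[pred z : V * V | e z.1 z.2]|)%N.
Proof.
set E := [pred z : V * V | e z.1 z.2].
apply: (@leq_trans (\rank (\sum_(z in E) <<edge_row q z.1 z.2>>)%MS)).
  apply/mxrankS/rigidity_matrix_subP => x y exy.
  by rewrite (sumsmx_sup (x, y)) ?genmxE.
apply: leq_trans (mxrank_sum_leqif _) _ => /=; rewrite -[#|E|]sum1_card.
by apply: leq_sum => z _; rewrite genmxE rank_leq_row.
Qed.

(** * The rank of the complete graph *)

Section Complete.
Variables (R : realType) (V : finType) (d : nat) (p : placement R V d).
Hypothesis p_gen : generic p.

(** By [edge_row_clique], the edges meeting a fixed set [K] of [d] vertices span all rows, and there
    are [d (#|V| - d) + 'C(d, 2)] of them. *)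
Lemma rank_complete : (d <= #|V|)%N ->
  (\rank (rigidity_matrix (fun _ _ => true) p) + 'C(d.+1, 2) <= d * #|V|)%N.
Proof.
move=> dV; have [K cK] : exists K : {set V}, #|K| = d.
  have [|f f_inj fK] := @ord_inj_in _ [set: V]%SET d; first by rewrite cardsT.
  exists [set f i | i : 'I_d]%SET.
  by rewrite card_imset // card_ord.
(* Each edge meeting [K] is oriented one way only, since [rank_le_card] counts ordered pairs. *)
pose e0 : rel V := fun x y =>
  (y \in K) && ((x \notin K) || (enum_rank x < enum_rank y)%N).
have sub0 x y : y \in K -> (edge_row p x y <= rigidity_matrix e0 p)%MS.
  move=> yK; case: (boolP (x \in K)) => xK; last first.
    by apply: edge_row_sub; rewrite /e0 yK xK.
  case: (ltngtP (enum_rank x) (enum_rank y)) => [lt|gt|/val_inj/enum_rank_inj ->].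
  - by apply: edge_row_sub; rewrite /e0 yK lt orbT.
  - by rewrite edge_rowC; apply: edge_row_sub; rewrite /e0 xK gt orbT.
  - by rewrite edge_row_diag sub0mx.
have sub x y : (edge_row p x y <= rigidity_matrix e0 p)%MS.
  case: (boolP (y \in K)) => yK; first exact: sub0.
  case: (boolP (x \in K)) => xK; first by rewrite edge_rowC sub0.
  have [->|xy] := eqVneq x y.
    by rewrite edge_row_diag sub0mx.
  by apply: (edge_row_clique p_gen _ xy xK yK) => [|v w _]; [rewrite cK|exact: sub0].
have : (\rank (rigidity_matrix (fun _ _ => true) p) <= \rank (rigidity_matrix e0 p))%N.
  by apply/mxrankS/rigidity_matrix_subP.
move=> /leq_trans/(_ (rank_le_card _ _)) rk.
pose A := finset.setX (~: K) K.
pose B := [set z in finset.setX K K | (enum_rank z.1 < enum_rank z.2)%N]%SET.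
pose B' := [set z in finset.setX K K | (enum_rank z.2 < enum_rank z.1)%N]%SET.
pose C := [set (x, x) | x in K]%SET.
have cA : #|A| = ((#|V| - d) * d)%N by rewrite cardsX cardsCs finset.setCK cK.
have cC : #|C| = d by rewrite card_imset // => a b [].
have cB : #|B'| = #|B|.
  have swap_inj : injective (fun z : V * V => (z.2, z.1)) by move=> [? ?] [? ?] [-> ->].
  rewrite -(card_imset B swap_inj); apply: eq_card => -[a b].
  apply/idP/imsetP => [|[[a' b'] + [-> ->]]]; rewrite !inE /=.
    by move=> /andP[/andP[aK bK] lt]; exists (b, a); rewrite // !inE /= aK bK.
  by move=> /andP[/andP[-> ->] ->].
(* The two triangles and the diagonal are disjoint in the square of [K]. *)
have cBC : (2 * #|B| + d <= d * d)%N.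
  have BB : (B :&: B' = finset.set0)%SET.
    apply/finset.setP => z; rewrite !inE; apply/negP => /andP[/andP[_ lt] /andP[_]].
    by rewrite ltnNge ltnW.
  have BC : ((B :|: B') :&: C = finset.set0)%SET.
    apply/finset.setP => z; rewrite !inE; apply/negP => /andP[+ /imsetP[a _ za]].
    by rewrite za /= ltnn !andbF.
  have : (B :|: B' :|: C \subset finset.setX K K)%SET.
    apply/fintype.subsetP => z; rewrite !inE => /orP[/orP[]/andP[] //|].
    by move=> /imsetP[a aK ->]; rewrite /= aK.
  move/subset_leq_card; rewrite cardsX cK !cardsU BB BC cards0 cB cC; lia.
have : (#|[pred z : V * V | e0 z.1 z.2]| <= #|A| + #|B|)%N.
  apply: leq_trans (leq_card_setU A B).
  apply/subset_leq_card/fintype.subsetP => -[x y]; rewrite !inE /= /e0.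
  by case: (x \in K); case: (y \in K).
rewrite cA => /(leq_trans rk); have := mul_bin_diag d.+1 1; rewrite bin1 /=.
move: cBC; have := subnKC dV; move: (#|V| - d)%N => k <-.
move: (\rank _) #|B| ('C(_, _)) => r b c; rewrite mulSn mulnDr (mulnC k); lia.
Qed.

End Complete.

(** * Averaging over vertex orders *)

Section Averaging.
Variable F : realFieldType.

(* In a uniformly random vertex order, a vertex with D neighbours is preceded by
   each number j = 0, ..., D of them with equal probability: mean_degree is the
   expectation of min(d, j), and mean_bonus the probability that j > d and that
   two given neighbours are among the preceding ones. *)
Definition mean_degree (d D : nat) : F :=
  (\sum_(j < D.+1) minn d j)%N%:R / D.+1%:R.

Definition mean_bonus (d D : nat) : F :=
  (\sum_(j < D.+1) (d < j) * (j * j.-1))%N%:R / (D.+1 * D * D.-1)%N%:R.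

(** Condition on which of a vertex and its [D] neighbours comes last: the vertex itself, or a
    neighbour, whose removal leaves [D.-1]. *)
Lemma mean_degree_rec d D :
  D.+1%:R * mean_degree d D = D%:R * mean_degree d D.-1 + (minn d D)%:R.
Proof.
case: D => [|D]; rewrite /mean_degree.
  by rewrite big_ord1 minn0 mul0r mul0r mulr0 addr0.
rewrite [LHS]mulrC [X in _ = X + _]mulrC !divfK ?pnatr_eq0 //.
by rewrite big_ord_recr natrD.
Qed.

(** The same conditioning: if one of the two given neighbours comes last, the bonus is lost, so only
    [k] neighbours contribute. *)
Lemma mean_bonus_rec d k :
  k.+3%:R * mean_bonus d k.+2 = k%:R * mean_bonus d k.+1 + (d < k.+2)%N%:R.
Proof.
rewrite /mean_bonus big_ord_recr /=; set A := (\sum_(j < k.+2) _)%N.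
(* For [k = 0] the term [mean_bonus d 1] has denominator zero, but its factor [k] vanishes. *)
have A0 : k = 0%N -> A = 0%N.
  by rewrite /A => ->; rewrite !big_ord_recr big_ord0 /= !muln0.
case: k A A0 => [|k] A A0; first by rewrite A0 // mulr0n mul0r add0r !natrM; field.
have k0 : 0 <= k%:R :> F := ler0n _ _.
by rewrite !(natrD, natrM); field; apply/and4P; split; rewrite gt_eqF //; lra.
Qed.

Variables (V : finType) (e : rel V) (d : nat).
Hypotheses (e_irr : irreflexive e).
Variables (x y : V -> V) (r : {set V} -> nat).
Implicit Types W : {set V}.
Local Notation N W u := (neighbours e W u).
Hypothesis xy_neq : forall u, x u != y u.
Hypothesis r_incr : forall (W : {set V}) u, u \in W ->
  (r (W :\ u) + minn d #|N W u| <= r W)%N.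
Hypothesis r_incr_bonus : forall (W : {set V}) u, u \in W -> (d < #|N W u|)%N ->
  x u \in N W u -> y u \in N W u -> (r (W :\ u) + d.+1 <= r W)%N.

Let both W u := (x u \in N W u) && (y u \in N W u).
(** The expected guaranteed gain at [v] when [W] is exposed in random order; [inc] is the gain of a
    vertex that comes last. *)
Let phi W v := mean_degree d #|N W v| + (both W v)%:R * mean_bonus d #|N W v|.
Let inc W u := (minn d #|N W u| + (both W u && (d < #|N W u|)))%N.

Let r_inc W u : u \in W -> (r (W :\ u) + inc W u <= r W)%N.
Proof.
move=> uW; rewrite /inc; case: (boolP (_ && _)) => [|_]; last first.
  by rewrite addn0 r_incr.
case/andP=> /andP[xN yN] dN; rewrite addn1 (minn_idPl (ltnW dN)).
exact: r_incr_bonus xN yN.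
Qed.

Let N_del W u v : N (W :\ u) v = N W v :\ u.
Proof. by apply/finset.setP=> w; rewrite !inE andbA. Qed.

(** Condition on the last vertex of [W]: if it is [v], the gain is [inc W v]; if it is another [u],
    the rest is a random order of [W :\ u]. *)
Let phi_rec W v : v \in W ->
  (#|W|)%:R * phi W v = \sum_(u in W :\ v) phi (W :\ u) v + (inc W v)%:R.
Proof.
move=> vW; set D := #|N W v|.
have NW : N W v \subset W :\ v.
  apply/fintype.subsetP => w; rewrite !inE => /andP[-> evw]; rewrite andbT.
  by apply: contraTneq evw => ->; rewrite e_irr.
(* Removing a non-neighbour of [v] leaves [phi] unchanged. *)
have -> : \sum_(u in W :\ v) phi (W :\ u) v =
    \sum_(u in N W v) phi (W :\ u) v + (#|W|.-1 - D)%N%:R * phi W v.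
  rewrite (big_setID (N W v)) /= (finset.setIidPr NW); congr (_ + _).
  rewrite (eq_bigr (fun=> phi W v)); last first.
    move=> u /finset.setDP[_ uN]; rewrite /phi /both.
    suff -> : N (W :\ u) v = N W v by [].
    by rewrite N_del; apply/finset.setDidPl; rewrite disjoint_sym disjoints1.
  rewrite sumr_const cardsD (finset.setIidPr NW) (cardsD1 v W) vW -/D.
  by rewrite mulr_natl.
have -> : \sum_(u in N W v) phi (W :\ u) v = D%:R * mean_degree d D.-1
    + (both W v)%:R * (D.-2%:R * mean_bonus d D.-1).
  have cD u : u \in N W v -> #|N W v :\ u| = D.-1.
    by move=> uN; rewrite /D (cardsD1 u (N W v)) uN.
  rewrite big_split /=; congr (_ + _).
    rewrite (eq_bigr (fun=> mean_degree d D.-1)) ?sumr_const ?mulr_natl //.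
    by move=> u uN; rewrite N_del cD.
  case: (boolP (both W v)) => [/andP[xN yN]|nb]; last first.
    rewrite mul0r big1 // => u uN; rewrite (_ : both _ _ = false) ?mul0r //.
    apply: contraNF nb; rewrite /both !N_del !inE.
    by move=> /andP[/andP[_ ->] /andP[_ ->]].
  rewrite mul1r.
  rewrite (big_setD1 (x v)) //= (big_setD1 (y v)) /=; last first.
    by rewrite in_setD1 yN eq_sym xy_neq.
  have -> : both (W :\ x v) v = false by rewrite /both !N_del in_setD1 eqxx.
  have -> : both (W :\ y v) v = false.
    by rewrite /both !N_del ![_ \in _ :\ y v]in_setD1 eqxx andbF.
  rewrite !mul0r !add0r (eq_bigr (fun=> mean_bonus d D.-1)); last first.
    move=> u /setD1P[uy /setD1P[ux uN]].
    rewrite /both N_del cD // !in_setD1 xN yN.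
    by rewrite ![_ == u]eq_sym ux uy mul1r.
  rewrite sumr_const mulr_natl; congr (_ *+ _).
  move: (cardsD1 (x v) (N W v)) (cardsD1 (y v) (N W v :\ x v)).
  by rewrite -/D xN in_setD1 eq_sym xy_neq yN /=; lia.
have DW : (D.+1 <= #|W|)%N.
  by have := subset_leq_card NW; rewrite -/D (cardsD1 v W) vW.
have -> : (#|W|)%:R = D.+1%:R + (#|W|.-1 - D)%N%:R :> F.
  by rewrite -natrD; congr _%:R; lia.
have bonus : D.+1%:R * ((both W v)%:R * mean_bonus d D) =
    (both W v)%:R * (D.-2%:R * mean_bonus d D.-1)
    + (both W v && (d < D)%N)%:R :> F.
  case: (boolP (both W v)) => [/andP[xN yN]|_]; last by rewrite !mul0r mulr0 addr0.
  have D2 : (1 < D)%N.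
    move: (cardsD1 (x v) (N W v)) (cardsD1 (y v) (N W v :\ x v)).
    by rewrite -/D xN in_setD1 eq_sym xy_neq yN /=; lia.
  move: D2; case: (D) => [//|[//|k]] _.
  by rewrite !mul1r mean_bonus_rec.
rewrite mulrDl {1}/phi -/D mulrDr mean_degree_rec bonus /inc -/D natrD.
by ring.
Qed.

(** Induction on [#|W|] replaces a probability space of orders: after multiplication by [#|W|],
    [phi_rec] and an exchange of sums group the terms by the last vertex [u], and each group is at
    most [r W]. *)
Let sum_phi_le W : \sum_(v in W) phi W v <= (r W)%:R.
Proof.
move: {2}#|W| (leqnn #|W|) => n; elim: n W => [|n IH] W cW.
  have -> : W = finset.set0 by apply/eqP; rewrite -cards_eq0 -leqn0.
  by rewrite big_set0 ler0n.
have [->|W0] := eqVneq W finset.set0; first by rewrite big_set0 ler0n.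
have Wpos : 0 < #|W|%:R :> F by rewrite ltr0n card_gt0.
rewrite -(ler_pM2l Wpos) mulr_sumr.
rewrite (eq_bigr (fun v => \sum_(u in W :\ v) phi (W :\ u) v + (inc W v)%:R));
  last by move=> v vW; rewrite phi_rec.
rewrite big_split /=.
have -> : \sum_(v in W) \sum_(u in W :\ v) phi (W :\ u) v =
    \sum_(u in W) \sum_(v in W :\ u) phi (W :\ u) v.
  rewrite (exchange_big_dep (mem W)) /=; last by move=> u v _ /setD1P[].
  apply: eq_bigr => u uW; apply: eq_bigl => v.
  by rewrite !in_setD1 uW andbT andbC eq_sym.
rewrite -big_split /= mulr_natl -sumr_const; apply: ler_sum => u uW.
apply: le_trans (_ : (r (W :\ u) + inc W u)%N%:R <= _); last first.
  by rewrite ler_nat r_inc.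
rewrite natrD lerD2r; apply: IH.
by move: cW; rewrite (cardsD1 u W) uW.
Qed.

Lemma sum_mean_le : (forall u, e u (x u)) -> (forall u, e u (y u)) ->
  \sum_v (mean_degree d #|[set w | e v w]%SET| + mean_bonus d #|[set w | e v w]%SET|)
  <= (r [set: V]%SET)%:R.
Proof.
move=> ex ey; apply: le_trans (sum_phi_le [set: V]%SET).
rewrite big_mkcond [leRHS]big_mkcond /=; apply: ler_sum => v _.
have NT : N [set: V]%SET v = [set w | e v w]%SET.
  by apply/finset.setP => w; rewrite !inE.
by rewrite inE /phi /both NT !inE ex ey mul1r.
Qed.

End Averaging.

(** * Closed forms and numerical bounds for the averages *)

Lemma sum_minn d D : (d <= D)%N ->
  (2 * (\sum_(j < D.+1) minn d j) + d * d.+1 = 2 * (d * D.+1))%N.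
Proof.
have small k : (k <= d)%N -> (2 * (\sum_(j < k.+1) minn d j) = k * k.+1)%N.
  elim: k => [|k IH] kd; first by rewrite big_ord1 minn0.
  by rewrite big_ord_recr /= mulnDr (IH (ltnW kd)) (minn_idPr kd) -mulnDl addn2 mulnC.
elim: D => [|D IH].
  by rewrite leqn0 => /eqP ->; rewrite big_ord1.
rewrite leq_eqVlt => /predU1P[dD|dD]; first by rewrite -dD small // addnn mul2n.
rewrite big_ord_recr /= (minn_idPl (ltnW dD)) mulnDr addnAC IH //.
by rewrite -mulnDr addnC -mulnS.
Qed.

(** Telescoping, as [3 j (j - 1) = (j + 1) j (j - 1) - j (j - 1) (j - 2)]. *)
Lemma sum_bonus d D : (d <= D)%N ->
  (3 * (\sum_(j < D.+1) (d < j) * (j * j.-1)) + d.+1 * d * d.-1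
   = D.+1 * D * D.-1)%N.
Proof.
elim: D => [|D IH].
  by rewrite leqn0 => /eqP ->; rewrite big_ord1.
rewrite leq_eqVlt => /predU1P[->|dD].
  by rewrite big1 ?muln0 // => j _; rewrite ltnNge -ltnS ltn_ord.
rewrite big_ord_recr /= dD mul1n mulnDr addnAC IH //; case: D {IH dD} => [|D] /=; lia.
Qed.

(** The mean degree is [d - d (d + 1) / (2 (D + 1))]. The bonus is one third of [1 - t], where [t]
    is a ratio of cubic products that is at most [1 / 10] once [D] is at least [d (d + 1)]. *)
Lemma mean_ge (F : realFieldType) n d D :
  (0 < d)%N -> (d * d.+1 <= D)%N -> (n + d <= 2 * D.+1)%N ->
  d%:R + 3 / 10 - (d * d.+1)%N%:R / (n + d)%N%:R <=
  mean_degree F d D + mean_bonus F d D.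
Proof.
move=> d0 dD nD.
have d_le_D : (d <= D)%N by lia.
have D0 : 0 < D.+1%:R :> F by rewrite ltr0n.
have ->  : mean_degree F d D = d%:R - (d * d.+1)%N%:R / (2 * D.+1)%N%:R.
  apply: (mulIf (lt0r_neq0 D0)); rewrite divfK ?lt0r_neq0 //.
  have := congr1 (fun k => k%:R : F) (sum_minn d_le_D).
  rewrite natrD !natrM mulrBl => sumE.
  rewrite [X in _ - X](_ : _ = d%:R * d.+1%:R / 2); first by lra.
  by field; rewrite addrC natr1 lt0r_neq0.
have le1 : (d * d.+1)%N%:R / (2 * D.+1)%N%:R <= (d * d.+1)%N%:R / (n + d)%N%:R :> F.
  rewrite ler_wpM2l ?ler0n // lef_pV2 ?posrE ?ltr0n ?ler_nat //; lia.
have bonus : 3 / 10 <= mean_bonus F d D.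
  rewrite /mean_bonus ler_pdivlMr ?ltr0n; last by nia.
  have := sum_bonus d_le_D.
  have : (10 * (d.+1 * d * d.-1) <= D.+1 * D * D.-1)%N.
    case: d d0 dD {nD d_le_D le1} => // -[|d] _ dD; first by rewrite !muln0.
    case: D dD {D0} => // D dD /=.
    nia.
  set S := (\sum_(j < _) _)%N; set a := (d.+1 * _ * _)%N; set b := (D.+1 * _ * _)%N.
  move=> ab Sab; rewrite -(ler_pM2l (_ : 0 < 10%:R)) ?ltr0n //.
  rewrite -natrM mulrA (_ : 10 * (3 / 10) = 3%:R :> F); last by field.
  by rewrite -natrM ler_nat; lia.
move: le1 bonus; move: (_ / (n + d)%N%:R) (_ / (2 * D.+1)%N%:R) (mean_bonus F d D).
by move=> x y z; lra.
Qed.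

(** * The closure of the graph *)

Section Closure.
Variables (R : realType) (V : finType) (d : nat) (p : placement R V d).
Hypothesis p_gen : generic p.
Variable G : sgraph V.
Hypothesis V_large : (2 * d ^ 2 + d + 2 <= #|V|)%N.
Hypothesis G_deg : forall v, (#|V| + d <= 2 * (degree G v).+1)%N.

Let span := rigidity_matrix G p.
Let linked : rel V := [rel x y | (x != y) && (edge_row p x y <= span)%MS].

Let edge_linked x y : G x y -> linked x y.
Proof.
move=> Gxy; rewrite /linked /= edge_row_sub // andbT.
by apply: contraTneq Gxy => ->; rewrite adj_irr.
Qed.

Let linkedC x y : linked x y = linked y x.
Proof. by rewrite /linked /= eq_sym edge_rowC. Qed.

(** Unlinked vertices are not adjacent, so both neighbourhoods lie among the other [#|V| - 2]
    vertices, while the degrees sum to at least [#|V| + d - 2]. *)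
Let not_linked_common x y : x != y -> ~~ linked x y ->
  (d <= #|[set w | G x w && G y w]%SET|)%N.
Proof.
move=> xy nxy.
pose A z := [set w | G z w]%SET.
have cA z : #|A z| = degree G z by rewrite cardsE.
have sub : (A x :|: A y \subset ~: [set x; y])%SET.
  apply/fintype.subsetP => w; rewrite !inE negb_or => /orP[] Gw.
    rewrite (contraTneq _ Gw) => [|->]; last by rewrite adj_irr.
    by apply: contraNneq nxy => <-; exact: edge_linked.
  rewrite andbC (contraTneq _ Gw) => [|->]; last by rewrite adj_irr.
  by apply: contraNneq nxy => <-; rewrite linkedC edge_linked.
have cxy : #|[set x; y]%SET| = 2 by rewrite cards2 xy.
move: (subset_leq_card sub) (cardsC [set x; y]%SET) (cardsUI (A x) (A y)).
have -> : (A x :&: A y = [set w | G x w && G y w])%SET.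
  by apply/finset.setP => w; rewrite !inE.
by rewrite cxy !cA; move: (G_deg x) (G_deg y); lia.
Qed.

(** Suppose the linked neighbourhood of [v] is a clique. Any [u] unlinked to [v] would share [d]
    neighbours with it, which form a clique, so [u] would be linked to [v] after all. Thus [v] is
    linked to everything, and then so are [a] and [b]. *)
Let no_clique_neighbourhood v a b : a != b -> ~~ linked a b ->
  exists xy : V * V, [/\ linked v xy.1, linked v xy.2, xy.1 != xy.2 &
    ~~ (edge_row p xy.1 xy.2 <= span)%MS].
Proof.
move=> ab nab; apply: contrapT => no.
have clique x y : linked v x -> linked v y -> x != y ->
    (edge_row p x y <= span)%MS.
  by move=> vx vy xy; apply: contrapT => /negP nxy; apply: no; exists (x, y).
have edge0 x : (edge_row p x x <= span)%MS.
  by rewrite edge_row_diag sub0mx.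
have all_linked u : u != v -> linked v u.
  move=> uv; apply: contrapT => /negP nvu.
  move: (nvu); rewrite linkedC /linked /= uv /= => /negP; apply.
  apply: (edge_row_clique p_gen (not_linked_common _ nvu)) => //.
  - by rewrite eq_sym.
  - by rewrite inE adj_irr andbF.
  - by rewrite inE adj_irr.
  - move=> x y + yK; move: (yK); rewrite inE => /andP[Gvy Guy].
    rewrite !inE => /or3P[/eqP->|/eqP->|/andP[Gvx Gux]]; try exact: edge_row_sub.
    have [->|xy] := eqVneq x y; first exact: edge0.
    by apply: clique => //; exact: edge_linked.
move: nab; rewrite /linked /= ab /=; case: (eqVneq a v) => [av|av].
  by rewrite av; move: (all_linked b); rewrite -av eq_sym ab => /(_ isT)/andP[_ ->].
have [bv|bv] := eqVneq b v.
  rewrite bv edge_rowC; move: (all_linked a).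
  by rewrite av => /(_ isT)/andP[_ ->].
by rewrite clique ?all_linked.
Qed.

Lemma closure_complete x y : (edge_row p x y <= rigidity_matrix G p)%MS.
Proof.
have [->|xy] := eqVneq x y.
  by rewrite edge_row_diag sub0mx.
apply: contrapT => /negP nxy.
have nl : ~~ linked x y by rewrite /linked /= xy.
(* In dimension zero there are no columns and every row is zero. *)
have d0 : (0 < d)%N.
  rewrite lt0n; apply: contra nxy => /eqP d0.
  rewrite (_ : edge_row _ _ _ = 0) ?sub0mx //; apply/rowP=> l.
  have := leq_ltn_trans (leq0n _) (ltn_ord (enum_val l).2).
  by move: d0; clear; lia.
have [xs /all_and4[x_l y_l xy_neq xy_n]] :=
  fin_all_exists (fun v => no_clique_neighbourhood v xy nl).
pose r W := \rank (rigidity_matrix (induced linked W) p).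
have l_irr : irreflexive linked by move=> v; rewrite /linked /= eqxx.
have l_span : (rigidity_matrix linked p <= span)%MS.
  by apply/rigidity_matrix_subP => v w /andP[].
have := @sum_mean_le R V linked d l_irr (fun v => (xs v).1) (fun v => (xs v).2)
  r xy_neq _ _ x_l y_l.
move=> /(_ (fun W u => @rank_increment _ _ _ _ p_gen linked W u l_irr)).
move=> /(_ (fun W u uW dN xN yN => @rank_increment_nonadjacent _ _ _ _ p_gen
  linked W u l_irr uW _ _ dN xN yN
  (contra (fun s => submx_trans s l_span) (xy_n u)))) sum_le.
have r_le : (r [set: V]%SET <= \rank span)%N.
  apply/mxrankS/rigidity_matrix_subP => v w /and3P[vw _ _].
  by apply: submx_trans l_span; exact: edge_row_sub.
(* The unlinked pair makes [span] deficient, which the averaging bound will contradict. *)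
have : (\rank span < \rank (rigidity_matrix (fun _ _ => true) p))%N.
  rewrite ltnNge; apply: contra nxy => rk.
  have full v w : (edge_row p v w <= rigidity_matrix (fun _ _ => true) p)%MS.
    exact: edge_row_sub.
  apply: submx_trans (full x y) _.
  rewrite -(geq_leqif (mxrank_leqif_sup _)) //.
  by apply/rigidity_matrix_subP => v w /edge_row_sub.
have := @rank_complete _ _ _ _ p_gen.
have dV : (d <= #|V|)%N by lia.
move=> /(_ dV) rkc rkl.
have bound : (d * #|V| <= \rank span + 'C(d.+1, 2))%N; last by lia.
have sum_ge : #|V|%:R * (d%:R + 3 / 10 - (d * d.+1)%N%:R / (#|V| + d)%N%:R)
    <= (\rank span)%:R :> R.
  apply: le_trans (le_trans sum_le _); last by rewrite ler_nat.
  rewrite mulr_natl -sumr_const; apply: ler_sum => v _.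
  have degv : (degree G v <= #|[set w | linked v w]%SET|)%N.
    rewrite -cardsE; apply/subset_leq_card/fintype.subsetP => w.
    by rewrite !inE; exact: edge_linked.
  have := G_deg v; move: degv; set D := #|[set w | linked v w]%SET| => degv Gv.
  (* [V_large] and the degree condition together give exactly [d * d.+1 <= D]. *)
  by apply: mean_ge => //; [nia|lia].
have Vd : 0 < (#|V| + d)%N%:R :> R by rewrite ltr0n; lia.
have frac : #|V|%:R * ((d * d.+1)%N%:R / (#|V| + d)%N%:R) <= (d * d.+1)%N%:R :> R.
  rewrite mulrCA ler_piMr ?ler0n // ler_pdivrMr // mul1r ler_nat leq_addr //.
have := mul_bin_diag d.+1 1; rewrite bin1 /= => binE.
have : (10 * d * #|V| + 3 * #|V| <= 10 * \rank span + 10 * (d * d.+1))%N.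
  rewrite -(ler_nat R) !(natrD, natrM).
  move: sum_ge frac; rewrite !natrM; lra.
(* What remains is that the total bonus [3 #|V| / 10] covers [d (d + 1) / 2], the excess of the loss
   [d (d + 1)] over the deficiency of the complete graph. *)
have dd : (2 * d <= d * d + 1)%N by case: (d) => // k; nia.
move: binE V_large dd; rewrite mulSn mulnS -mulnA -mulnn.
move: (\rank span) ('C(_, _)) #|V| (d * d)%N (d * #|V|)%N.
by move=> rk c n dd dn; lia.
Qed.

End Closure.

(** * From complete closure to rigidity *)

Section Kernel.
Variables (R : realType) (V : finType) (d : nat).
Implicit Types (e : rel V) (m u p q : placement R V d).

Definition dot (v w : 'rV[R]_d) : R := \sum_i v 0 i * w 0 i.

Lemma edge_row_mul m u x y :
  edge_row m x y *m (\col_(l < #|{: V * 'I_d}|) u (enum_val l).1 0 (enum_val l).2)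
  = (dot (m x - m y) (u x - u y))%:M.
Proof.
apply/matrixP => i j; rewrite !ord1 !mxE mulr1n.
pose F w k := (((w == x)%:R - (w == y)%:R) * (m x 0 k - m y 0 k)) * u w 0 k.
transitivity (\sum_(z : V * 'I_d) F z.1 z.2).
  rewrite (reindex (fun l : 'I_#|{: V * 'I_d}| => enum_val l)) /=; last first.
    by apply: onW_bij; exact: enum_val_bij.
  by apply: eq_bigr => l _; rewrite !mxE.
rewrite -(pair_bigA _ F) exchange_big /dot; apply: eq_bigr => k _ /=.
rewrite (eq_bigr (fun w => (w == x)%:R * ((m x 0 k - m y 0 k) * u w 0 k)
  - (w == y)%:R * ((m x 0 k - m y 0 k) * u w 0 k))); last first.
  by move=> w _; rewrite /F; ring.
by rewrite sumrB !sum_delta !mxE; ring.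
Qed.

(** A velocity field orthogonal to all rows is orthogonal to their span. *)
Lemma row_space_flex e m u x y :
  (edge_row m x y <= rigidity_matrix e m)%MS ->
  (forall v w, e v w -> dot (m v - m w) (u v - u w) = 0) ->
  dot (m x - m y) (u x - u y) = 0.
Proof.
move=> /submxP[c xyE] flex.
pose U := \col_(l < #|{: V * 'I_d}|) u (enum_val l).1 0 (enum_val l).2.
have MU : rigidity_matrix e m *m U = 0.
  apply/row_matrixP => k; rewrite row_mul rowK row0.
  by case: ifP => [/flex h|_]; rewrite ?mul0mx // edge_row_mul h -scalemx1 scale0r.
have := edge_row_mul m u x y; rewrite xyE -mulmxA MU mulmx0.
by move=> /matrixP/(_ 0 0); rewrite !mxE mulr1n.
Qed.

Definition sqdist (v w : 'rV[R]_d) : R := dot (v - w) (v - w).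

Lemma eucl_dist_sqdist (v w v' w' : 'rV[R]_d) :
  eucl_dist v w = eucl_dist v' w' <-> sqdist v w = sqdist v' w'.
Proof.
have E x y : eucl_dist x y = Num.sqrt (sqdist x y).
  by congr Num.sqrt; apply: eq_bigr => i _; rewrite !mxE expr2.
have pos x y : 0 <= sqdist x y.
  by apply: sumr_ge0 => i _; rewrite -expr2 sqr_ge0.
rewrite !E; split=> [/eqP|-> //]; by rewrite eqr_sqrt // => /eqP.
Qed.

Lemma dot_midpoint p q x y :
  dot (2^-1 *: (p x + q x) - 2^-1 *: (p y + q y)) ((q x - p x) - (q y - p y))
  = 2^-1 * (sqdist (q x) (q y) - sqdist (p x) (p y)).
Proof.
rewrite /sqdist /dot -sumrB mulr_sumr; apply: eq_bigr => i _.
by rewrite !mxE; field.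
Qed.

Variables (p : placement R V d) (G : sgraph V).
Hypothesis p_gen : generic p.
Hypothesis complete : forall x y, (edge_row p x y <= rigidity_matrix G p)%MS.

(** At the midpoint [m], the complete graph has rank at most its rank at [p], which is that of [G]
    at [p], hence at most that of [G] at [m]. So both have the same row space at [m], and [q - p] is
    a flex of every pair. *)
Lemma equal_lengths q :
  (\rank (rigidity_matrix G p) <=
   \rank (rigidity_matrix G (fun v => 2^-1 *: (p v + q v))))%N ->
  (forall x y, G x y -> sqdist (q x) (q y) = sqdist (p x) (p y)) ->
  forall x y, sqdist (q x) (q y) = sqdist (p x) (p y).
Proof.
move=> rk len x y; set m : placement R V d := fun v => _ in rk.
have sub : (rigidity_matrix (fun _ _ => true) m <= rigidity_matrix G m)%MS.
  have Gm : (rigidity_matrix G m <= rigidity_matrix (fun _ _ => true) m)%MS.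
    by apply/rigidity_matrix_subP => v w _; exact: edge_row_sub.
  rewrite -(geq_leqif (mxrank_leqif_sup Gm)).
  apply: leq_trans (rigidity_rank_max p_gen _ m) (leq_trans _ rk).
  by apply/mxrankS/rigidity_matrix_subP.
have mxy : (edge_row m x y <= rigidity_matrix G m)%MS.
  by apply: submx_trans sub; exact: edge_row_sub.
have := @row_space_flex _ m (fun v => q v - p v) x y mxy.
rewrite dot_midpoint => /(_ _)/eqP.
rewrite mulf_eq0 invr_eq0 pnatr_eq0 /= subr_eq0 => h; apply/eqP/h => v w Gvw.
by rewrite dot_midpoint len // subrr mulr0.
Qed.

End Kernel.

(** * Isometries between placements with equal distances *)

Section Congruence.
Variables (R : realType) (V : finType) (d : nat).
Implicit Types p g : placement R V d.

Lemma mulmx_tr_dot m n (A : 'M[R]_(m, d)) (B : 'M[R]_(n, d)) i j :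
  (A *m B^T) i j = dot (row i A) (row j B).
Proof. by rewrite mxE; apply: eq_bigr => k _; rewrite !mxE. Qed.

Lemma sqdist_mul_orthogonal (A : 'M[R]_d) v w :
  A *m A^T = 1%:M -> sqdist (v *m A) (w *m A) = sqdist v w.
Proof.
move=> AA; have dotE (u : 'rV[R]_d) : dot u u = (u *m u^T) 0 0.
  by rewrite mulmx_tr_dot !row_id.
by rewrite /sqdist -mulmxBl !dotE trmx_mul mulmxA -(mulmxA _ A) AA mulmx1.
Qed.

Lemma dot_polar p g x y z :
  (forall x y, sqdist (g x) (g y) = sqdist (p x) (p y)) ->
  dot (g x - g z) (g y - g z) = dot (p x - p z) (p y - p z).
Proof.
move=> eq_dist; have polar q : dot (q x - q z) (q y - q z) =
    2^-1 * (sqdist (q x) (q z) + sqdist (q y) (q z) - sqdist (q x) (q y)).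
  rewrite /sqdist /dot -big_split -sumrB mulr_sumr; apply: eq_bigr => i _ /=.
  by rewrite !mxE; field.
by rewrite !polar !eq_dist.
Qed.

(** [A] carries the frame at [p z] to the frame at [g z]. Equal Gram matrices make it orthogonal,
    and a vector is determined by its products with a frame. *)
Lemma congruence p g (f : 'I_d -> V) z :
  (forall x y, sqdist (g x) (g y) = sqdist (p x) (p y)) ->
  \matrix_i (p (f i) - p z) \in unitmx ->
  let A := invmx (\matrix_i (p (f i) - p z)) *m \matrix_i (g (f i) - g z) in
  A *m A^T = 1%:M /\ forall v, g v - g z = (p v - p z) *m A.
Proof.
move=> eq_dist; set P := \matrix_i _; set Q := \matrix_i (g _ - _) => P_unit A.
have gram : Q *m Q^T = P *m P^T.
  by apply/matrixP => i j; rewrite !mulmx_tr_dot !rowK; exact: dot_polar.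
have AA : A *m A^T = 1%:M.
  rewrite /A trmx_mul mulmxA -(mulmxA _ Q) gram mulmxA mulVmx // mul1mx.
  by rewrite -trmx_mul mulVmx // trmx1.
split=> // v.
have Q_unit : Q^T \in unitmx.
  by rewrite unitmx_tr -(mulKVmx P_unit Q) unitmx_mul P_unit (mulmx1_unit AA).1.
apply: (can_inj (mulmxK Q_unit)).
transitivity ((p v - p z) *m P^T); last first.
  have -> : Q = P *m A by rewrite mulKVmx.
  by rewrite trmx_mul -mulmxA (mulmxA A) AA mul1mx.
by apply/rowP => j; rewrite !mulmx_tr_dot !row_id !rowK; exact: dot_polar.
Qed.

End Congruence.

(** * Continuity and connectedness *)

Section Topology.
Local Open Scope classical_set_scope.

Lemma continuous_mx (T : topologicalType) (K : topologicalType) m n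
    (M : T -> 'M[K]_(m, n)) :
  (forall i j, continuous (fun t => M t i j)) -> continuous M.
Proof.
move=> cM t A [P MP PA].
have : \forall s \near t, forall i j, P i j (M s i j).
  by do 2 apply: filter_forall => ?; exact: cM (MP _ _).
by apply: filterS => s Ps; apply: PA.
Qed.

Section Real.
Variable R : realType.

Lemma continuous_bigsum (I : finType) (F : I -> R -> R) :
  (forall i, continuous (F i)) -> continuous (fun t => \sum_i F i t).
Proof. by move=> cF t; apply: (cvg_big (@add_continuous _)) => i _; exact: cF. Qed.

Lemma continuous_det k (M : R -> 'M[R]_k) :
  (forall i j, continuous (fun t => M t i j)) -> continuous (fun t => \det (M t)).
Proof.
move=> cM; apply: continuous_bigsum => s t.
apply: cvgM; first exact: cvg_cst.
by apply: (cvg_big (@mul_continuous _)) => i _; exact: cM.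
Qed.

Lemma clopen_all (I : set R) : I 0 -> open I -> closed I -> forall t, I t.
Proof.
move=> I0 oI cI t.
have conn : connected [set: R] by apply/connected_intervalP.
have -> : I = setT by apply: conn; [exists 0|exists I|exists I]; rewrite ?setTI.
by [].
Qed.

(** Retraction onto the unit interval: composing with it extends a motion continuously to all
    times. *)
Definition clamp (t : R) : R := Num.max 0 (Num.min t 1).

Lemma clamp_in t : clamp t \in `[0, 1]%R.
Proof.
rewrite in_itv /= /clamp le_max lexx ge_max ler01 /= ge_min.
by rewrite lexx orbT.
Qed.

Lemma clampE t : t \in `[0, 1]%R -> clamp t = t.
Proof.
by rewrite in_itv /= => /andP[t0 t1]; rewrite /clamp min_l // max_r.
Qed.

Lemma continuous_clamp (T : topologicalType) (f : R -> T) :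
  {within `[0, 1], continuous f} -> continuous (f \o clamp).
Proof.
move=> /subspace_continuousP cf t.
have cc : {for t, continuous clamp}.
  apply: (@continuous_max R R (fun=> 0) (fun s => Num.min s 1)).
    exact: cvg_cst.
  by apply: (@continuous_min R R id (fun=> 1)); [exact: cvg_id|exact: cvg_cst].
apply: cvg_comp (cf _ (clamp_in t)) => A; rewrite /within /= => wA.
have : nbhs t (clamp @^-1` [set s | s \in `[0, 1]%R -> A s]) by exact: cc wA.
apply: filterS => s; apply.
exact: clamp_in.
Qed.

End Real.
End Topology.

Section Rigidity.
Local Open Scope classical_set_scope.
Variables (R : realType) (V : finType) (d : nat) (p : placement R V d).
Variable G : sgraph V.
Hypothesis p_gen : generic p.
Hypothesis complete : forall x y, (edge_row p x y <= rigidity_matrix G p)%MS.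
Hypothesis dV : (d < #|V|)%N.

(** At [t0] the midpoint is [p] itself; a minor nonzero there stays nonzero nearby. *)
Lemma rank_near (q : R -> placement R V d) t0 :
  (forall v i, continuous (fun t => q t v 0 i)) -> q t0 = p ->
  \forall t \near t0, (\rank (rigidity_matrix G p) <=
    \rank (rigidity_matrix G (fun v => 2^-1 *: (p v + q t v)%R)))%N.
Proof.
move=> cq q0; have [f [g nz]] := rank_minor_ex (rigidity_matrix G p).
pose m t : placement R V d := fun v => 2^-1 *: (p v + q t v).
have m0 : m t0 = p.
  by apply/funext => v; rewrite /m q0; apply/rowP => i; rewrite !mxE; field.
have cm v i : continuous (fun t => m t v 0 i).
  have -> : (fun t => m t v 0 i) = (fun t => 2^-1 * (p v 0 i + q t v 0 i)).
    by apply/funext => t; rewrite !mxE.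
  move=> t; apply: cvgM; first exact: cvg_cst.
  by apply: cvgD; [exact: cvg_cst|exact: cq].
have : {for t0, continuous (fun t => \det (mxsub f g (rigidity_matrix G (m t))))}.
  apply: continuous_det => i j.
  case Gxy: (G (enum_val (f i)).1 (enum_val (f i)).2); last first.
    have -> : (fun t => mxsub f g (rigidity_matrix G (m t)) i j) = (fun=> 0).
      by apply/funext => t; rewrite !mxE Gxy mxE.
    by move=> t; exact: cvg_cst.
  set x := (enum_val (f i)).1; set y := (enum_val (f i)).2.
  set w := (enum_val (g j)).1; set k := (enum_val (g j)).2.
  have -> : (fun t => mxsub f g (rigidity_matrix G (m t)) i j) =
      (fun t => ((w == x)%:R - (w == y)%:R) * (m t x 0 k - m t y 0 k)).
    by apply/funext => t; rewrite !mxE Gxy !mxE.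
  move=> t; apply: cvgM; first exact: cvg_cst.
  by apply: cvgB; exact: cm.
move=> /(cvgr_neq0 _); rewrite m0 => /(_ nz).
by apply: filterS => t; exact: rank_minor_le.
Qed.

Lemma rigid_of_complete : rigid G p.
Proof.
move=> gamma [cg g0 g_len].
have [z _] : exists z : V, z \in [set: V]%SET.
  by apply/card_gt0P; rewrite cardsT; lia.
have [|f f_inj fz] := @ord_inj_in _ [set~ z]%SET d.
  by rewrite cardsC1; lia.
have P_unit : \matrix_i (p (f i) - p z) \in unitmx.
  rewrite -row_free_unit; apply: generic_diff_free => // i.
  by have := fz i; rewrite !inE.
pose h t : placement R V d := gamma (clamp t).
have ch v i : continuous (fun t => h t v 0 i).
  move=> t; apply: (@continuous_comp _ _ _ (fun t => h t v) (fun M : 'rV[R]_d => M 0 i)).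
    exact: (continuous_clamp (cg v)).
  exact: coord_continuous.
have h0 : h 0 = p.
  by apply/funext => v; rewrite /h clampE ?g0 // in_itv /= lexx ler01.
have csq v w : continuous (fun t => sqdist (h t v) (h t w)).
  apply: continuous_bigsum => i.
  have -> : (fun t => (h t v - h t w) 0 i * (h t v - h t w) 0 i) =
    (fun t => (h t v 0 i - h t w 0 i) * (h t v 0 i - h t w 0 i)).
    by apply/funext => t; rewrite !mxE.
  by move=> t; apply: cvgM; apply: cvgB; exact: ch.
have h_len t x y : G x y -> sqdist (h t x) (h t y) = sqdist (p x) (p y).
  by move=> Gxy; apply/eucl_dist_sqdist/g_len => //; exact: clamp_in.
have eq_dist : forall t x y, sqdist (h t x) (h t y) = sqdist (p x) (p y).
  apply: (@clopen_all _ [set t | forall x y,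
      sqdist (h t x) (h t y) = sqdist (p x) (p y)]).
  - by rewrite /= h0.
  (* Genericity is known at [p] only, so the placements near time [t0] are carried back by the
     isometry taking [h t0] to [p]; this keeps distances. *)
  - rewrite openE => t0 /= eq0.
    have [AA hA] := congruence eq0 P_unit.
    set A := invmx _ *m _ in AA hA.
    pose q t : placement R V d := fun v => p z + (h t v - h t0 z) *m A^T.
    have q_dist t x y : sqdist (q t x) (q t y) = sqdist (h t x) (h t y).
      have AtA : A^T *m A^T^T = 1%:M by rewrite trmxK; exact: mulmx1C AA.
      have shift (a b c : 'rV[R]_d) : sqdist (a + b) (a + c) = sqdist b c.
        by rewrite /sqdist opprD addrACA subrr add0r.
      rewrite /q shift sqdist_mul_orthogonal // ![_ - h t0 z]addrC shift //.
    have q0 : q t0 = p.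
      by apply/funext => v; rewrite /q hA -mulmxA AA mulmx1 addrC subrK.
    have cq v i : continuous (fun t => q t v 0 i).
      have -> : (fun t => q t v 0 i) =
          (fun t => p z 0 i + \sum_j (h t v 0 j - h t0 z 0 j) * A^T j i).
        apply/funext => t; rewrite !mxE; congr (_ + _).
        by apply: eq_bigr => j _; rewrite !mxE.
      move=> t; apply: cvgD; first exact: cvg_cst.
      apply: continuous_bigsum => j {}t; apply: cvgM; last exact: cvg_cst.
      by apply: cvgB; [exact: ch|exact: cvg_cst].
    have := rank_near cq q0; apply: filterS => t rk x y.
    rewrite -q_dist; apply: (equal_lengths p_gen complete rk) => v w Gvw.
    by rewrite q_dist h_len.
  - rewrite (_ : [set t | _] = \bigcap_(xy in [set: V * V])
        ((fun t => sqdist (h t xy.1) (h t xy.2)) @^-1`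
          [set s | s = sqdist (p xy.1) (p xy.2)])).
      apply: closed_bigI => xy _; apply: preimage_closed; last exact: closed_eq.
      by move=> t _; exact: csq.
    apply/seteqP; split => t /= H; first by move=> [x y] _; exact: H.
    by move=> x y; exact: (H (x, y)).
pose A t := invmx (\matrix_i (p (f i) - p z)) *m \matrix_i (h t (f i) - h t z).
have hA t : A t *m (A t)^T = 1%:M /\ forall v, h t v - h t z = (p v - p z) *m A t.
  exact: congruence (eq_dist t) P_unit.
have cA i j : continuous (fun t => A t i j).
  have -> : (fun t => A t i j) = (fun t => \sum_k
      invmx (\matrix_i (p (f i) - p z)) i k * (h t (f k) 0 j - h t z 0 j)).
    by apply/funext => t; rewrite mxE; apply: eq_bigr => k _; rewrite !mxE.
  apply: continuous_bigsum => k t; apply: cvgM; first exact: cvg_cst.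
  by apply: cvgB; exact: ch.
have A0 : A 0 = 1%:M by rewrite /A h0 mulVmx.
(* The determinant of an orthogonal matrix is 1 or -1; by continuity it keeps its initial value. *)
have detA : forall t, \det (A t) = 1.
  have cdet : continuous (fun t => \det (A t)) by exact: continuous_det.
  have det2 t : \det (A t) != -1 -> \det (A t) = 1.
    have := congr1 determinant (hA t).1.
    rewrite det_mulmx det_tr det1 -expr2 => /eqP; rewrite sqrf_eq1.
    by move=> /orP[/eqP //|->].
  apply: (@clopen_all _ [set t | \det (A t) = 1]).
  - by rewrite /= A0 det1.
  - rewrite openE => t /= dt.
    have nz : \det (A t) + 1 != 0 by rewrite dt -[1 + 1]/(2%:R) pnatr_eq0.
    have : (fun s => \det (A s) + 1) @ t --> \det (A t) + 1.
      by apply: cvgD; [exact: cdet|exact: cvg_cst].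
    move=> /(cvgr_neq0 _)/(_ nz); apply: filterS => s.
    by rewrite addr_eq0 => /det2.
  - apply: (@preimage_closed _ _ (fun t => \det (A t)) [set s | s = 1]).
      by move=> t _; exact: cdet.
    exact: closed_eq.
(* The translation is forced by the image of [z]. *)
exists A, (fun t => h t z - p z *m A t); split.
- split; apply: continuous_subspaceT; apply: continuous_mx => i j.
    exact: cA.
  rewrite ord1.
  have -> : (fun t => (h t z - p z *m A t) 0 j) =
      (fun t => h t z 0 j - \sum_k p z 0 k * A t k j).
    by apply/funext => t; rewrite !mxE.
  move=> t; apply: cvgB; first exact: ch.
  by apply: continuous_bigsum => k {}t; apply: cvgM; [exact: cvg_cst|exact: cA].
- by rewrite A0 h0 mulmx1 subrr.
- by move=> t _; split; [exact: (hA t).1|exact: detA].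
- move=> t v tI; have := (hA t).2 v; rewrite mulmxBl /h clampE //.
  by move=> /(canRL (subrK _)) ->; rewrite addrAC -addrA addrC.
Qed.

End Rigidity.

Lemma min_degree_le (V : finType) (G : sgraph V) v :
  (min_degree G <= degree G v)%N.
Proof.
rewrite /min_degree; have := mem_index_enum v.
elim: (index_enum V) => // w s IH; rewrite inE big_cons geq_min.
by case/predU1P => [->|/IH ->]; rewrite ?leqnn ?orbT.
Qed.

Theorem theorem1p1 (R : realType) (n d : nat) (hn : (2 <= n)%N)
    (hd : d%:R <= (Num.sqrt (8%:R * n%:R - 15%:R) - 1) / 4%:R :> R)
    (V : finType) (hV : #|V| = n) (G : sgraph V)
    (hG : (n%:R + d%:R) / 2%:R - 1 <= (min_degree G)%:R :> R) :
  d_rigid R d G.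
Proof.
(* Squaring [hd] gives [(4 d + 1)^2 <= 8 n - 15], which is this bound times 8. *)
have V_large : (2 * d ^ 2 + d + 2 <= #|V|)%N.
  have n2 : 2%:R <= n%:R :> R by rewrite ler_nat.
  have : (4 * d%:R + 1) ^+ 2 <= 8%:R * n%:R - 15%:R :> R.
    rewrite -[leRHS]sqr_sqrtr; last by lra.
    have d0 : 0 <= d%:R :> R := ler0n _ _.
    by rewrite lerXn2r ?nnegrE ?sqrtr_ge0 //; lra.
  move=> sq; by rewrite hV -mulnn -(ler_nat R) !(natrD, natrM); move: sq; lra.
have G_deg v : (#|V| + d <= 2 * (degree G v).+1)%N.
  apply: (@leq_trans (2 * (min_degree G).+1)); last first.
    by rewrite leq_mul2l ltnS min_degree_le.
  by rewrite hV -(ler_nat R) natrD natrM -natr1; move: hG; lra.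
move=> p p_gen; apply: rigid_of_complete => //.
  exact: closure_complete.
by lia.
Qed.
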